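(* The $n$-th Fibonacci polynomial $f_n(x)$, considered in characteristic $2$ (as a polynomial over $\mathbb{Z}_2=\mathbb{Z}/2\mathbb{Z}$), is self-reciprocal if and only if $n\in\{3,5\}$.
   Context: The Fibonacci polynomials are defined by $f_0(x)=0$, $f_1(x)=1$, and $f_n(x)=xf_{n-1}(x)+f_{n-2}(x)$ for $n\ge 2$; here their coefficients are reduced modulo $2$. The reciprocal of a polynomial $f(x)$ of degree $d$ is $f^*(x)=x^d f(1/x)$. A polynomial $f$ is called self-reciprocal if $f^*=f$, i.e. if $f(x)=a_0+a_1x+\cdots+a_dx^d$ with $a_d\neq 0$, then $a_i=a_{d-i}$ for all $0\le i\le d$.
   Formalization: The case n = 1 is excluded, because f_1(x) = 1 is a constant equal to its own reciprocal and hence self-reciprocal although 1 is not in {3,5}; the zero polynomial f_0, which has no degree, counts as not self-reciprocal. *)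

(* Defs.v *)
From mathcomp Require Import all_boot all_order all_algebra.

Set Implicit Arguments.
Unset Strict Implicit.
Unset Printing Implicit Defensive.

Import GRing.Theory.
Local Open Scope ring_scope.

Fixpoint fibp (n : nat) : {poly int} :=
  match n with
  | 0 => 0
  | 1 => 1
  | (m.+1 as k).+1 => 'X * fibp k + fibp m
  end.

Definition fibp2 (n : nat) : {poly 'F_2} := map_poly intr (fibp n).

(* x^d p(1/x) with d = (size p).-1 the degree of p: the coefficient of x^i
   is the coefficient of x^(d - i) in p. *)
Definition recip (R : nzRingType) (p : {poly R}) : {poly R} :=
  \poly_(i < size p) p`_((size p).-1 - i).

(* The reciprocal is only meaningful for a polynomial that has a degree, so
   the zero polynomial, for which recip 0 = 0, is excluded explicitly. *)
Definition self_reciprocal (R : nzRingType) (p : {poly R}) : Prop :=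
  p <> 0 /\ recip p = p.

(* Main.v *)
Require Import Defs.
From mathcomp Require Import all_boot all_order all_algebra.

(* The coefficient of x^i in f_(n+1) is C((n+i)/2, i) when n + i is even.  For
   even n > 0 the constant term of f_n vanishes while f_n is monic of degree
   n - 1.  For n = 2m+1, self-reciprocity says C(2m-j, j) = C(m+j, 2j) mod 2 for
   all j <= m.  Binomials C(a, b) with b < 16 have a parity that is 16-periodic
   in a, so these congruences for j <= 5 only depend on m mod 16, and they are
   inconsistent in each of the 16 classes.  This excludes m >= 5, and the
   cases m < 5 are checked directly. *)

Import GRing.Theory.

(** The recurrence becomes Pascal's rule [binS]; as it has two steps, the induction carries two
    consecutive indices. *)
Lemma coef_fibp (n i : nat) :
  ((fibp n.+1)`_i = (~~ odd (n + i) * 'C((n + i)./2, i))%N%:R)%R.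
Proof.
suff: (forall i, ((fibp n.+1)`_i = (~~ odd (n + i) * 'C((n + i)./2, i))%N%:R)%R)
   /\ (forall i, ((fibp n.+2)`_i = (~~ odd (n.+1 + i) * 'C((n.+1 + i)./2, i))%N%:R)%R).
  by case.
elim: n {i} => [|n [IH1 IH2]].
  split=> i /=; rewrite ?mulr1 ?addr0 ?coef1 ?coefX; case: i => [|[|i]] //=.
    by rewrite bin_small ?muln0 // !ltnS leq_half_double -addnn -addnS leq_addr.
  by rewrite bin_small ?muln0 // !ltnS leq_uphalf_double -addnn leq_addr.
split=> //.
have -> : fibp n.+3 = ('X * fibp n.+2 + fibp n.+1)%R by [].
case=> [|i]; rewrite coefD coefXM /=.
  by rewrite add0r IH1 !addn0 /= !bin0 negbK.
rewrite IH1 IH2 !addSn !addnS /= negbK binS.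
by case: (odd (n + i)); rewrite ?mul0n ?addr0 // !mul1n -natrD addnC.
Qed.

Lemma coef_fibp2 (n i : nat) :
  ((fibp2 n.+1)`_i = (~~ odd (n + i) * 'C((n + i)./2, i))%N%:R)%R.
Proof. by rewrite coef_map coef_fibp /= rmorph_nat. Qed.

Lemma natF2_eq (a b : nat) : (a%:R == b%:R :> 'F_2)%R = (odd a == odd b).
Proof. by rewrite -val_eqE /= !val_Fp_nat // !modn2; do 2!case: (odd _). Qed.

Lemma size_fibp2 (n : nat) : size (fibp2 n) = n.
Proof.
case: n => [|n]; first by rewrite /fibp2 rmorph0 size_poly0.
apply/eqP; rewrite eqn_leq; apply/andP; split.
  apply/leq_sizeP => j lt_nj; rewrite coef_fibp2 bin_small ?muln0 //.
  by rewrite ltn_half_double -addnn ltn_add2r.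
(* The coefficient of x^n is C(n, n) = 1. *)
rewrite ltnNge; apply/negP => /leq_sizeP/(_ n (leqnn n))/eqP.
by rewrite coef_fibp2 addnn odd_double doubleK binn oner_eq0.
Qed.

(** C(16, k) is even for 0 < k < 16, which settles n = 0; Pascal's rule propagates the period. *)
Lemma odd_bin_add16 (n k : nat) : k < 16 -> odd 'C(n + 16, k) = odd 'C(n, k).
Proof.
elim: n k => [|n IHn] [|k] lt_k; rewrite ?bin0 //.
  by move: lt_k; do 15!(case: k => [|k]; first by vm_compute).
by rewrite addSn !binS !oddD !IHn // ltnW.
Qed.

Lemma odd_bin_mod16 (n k : nat) : k < 16 -> odd 'C(n, k) = odd 'C(n %% 16, k).
Proof.
move=> lt_k; rewrite {1}(divn_eq n 16) addnC.
elim: (n %/ 16) => [|q IHq]; first by rewrite addn0.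
by rewrite mulSn addnCA addnC odd_bin_add16.
Qed.

Lemma odd_bin_reflection_small (m : nat) :
  (forall j, j <= m -> odd 'C(2 * m - j, j) = odd 'C(m + j, 2 * j)) ->
  m < 5.
Proof.
move=> sym; rewrite ltnNge; apply/negP => le5m.
pose q := m %/ 16; pose r := m %% 16.
have Em : m = q * 16 + r := divn_eq m 16.
(* The extra 16 keeps the natural subtraction from truncating when 2r < j. *)
have sym_mod j : 0 < j <= 5 ->
    odd 'C((2 * r + 16 - j) %% 16, j) = odd 'C((r + j) %% 16, 2 * j).
  case/andP=> lt0j lej5; have lejm := leq_trans lej5 le5m.
  have lt2j : 2 * j < 16 by rewrite (@leq_ltn_trans (2 * 5)) // leq_mul2l.
  have ltj : j < 16 by apply: leq_ltn_trans lej5 _.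
  have := sym j lejm; rewrite odd_bin_mod16 // [in RHS]odd_bin_mod16 //.
  suff -> : (2 * m - j) %% 16 = (2 * r + 16 - j) %% 16.
    by rewrite {1}Em -addnA modnMDl.
  have le_j2m : j <= 2 * m by rewrite (leq_trans lejm) // leq_pmull.
  rewrite -(modnDr (2 * m - j)) addnC addnBA // [16 + _]addnC Em.
  rewrite mulnDr mulnA -addnA -addnBA ?modnMDl //.
  by rewrite (leq_trans (ltnW ltj)) // leq_addl.
pose sym5 r := all (fun j => odd 'C((2 * r + 16 - j) %% 16, j) ==
                              odd 'C((r + j) %% 16, 2 * j)) (iota 1 5).
have no_sym5 : all (fun r => ~~ sym5 r) (iota 0 16) by vm_compute.
have r_range : r \in iota 0 16 by rewrite mem_iota ltn_mod.
apply: (negP (allP no_sym5 r r_range)); apply/allP => j.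
by rewrite mem_iota => range_j; rewrite sym_mod.
Qed.

Theorem theorem2p4 (n : nat) (hn : n <> 1) :
  self_reciprocal (fibp2 n) <-> n = 3 \/ n = 5.
Proof.
split=> [[nz sym] | n35].
  case: n hn nz sym => [|n] hn nz sym; first by case: nz; rewrite /fibp2 rmorph0.
  have coef_sym i : i <= n -> ((fibp2 n.+1)`_(n - i)%N = (fibp2 n.+1)`_i)%R.
    by move=> le_in; rewrite -[in RHS]sym /recip [in RHS]coef_poly size_fibp2 ltnS le_in.
  case: (boolP (odd n)) => [odd_n | even_n].
    (* The polynomial is f_(n+1), so its index is even here: leading coefficient 1, constant term
       0. *)
    have /eqP := coef_sym 0 isT.
    by rewrite subn0 !coef_fibp2 addnn addn0 odd_double odd_n doubleK binn natF2_eq.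
  pose m := n./2.
  have En : n = m.*2 by rewrite -[LHS]odd_double_half (negPf even_n).
  have lt_m5 : m < 5.
    apply: odd_bin_reflection_small => j le_jm.
    have le_j2m : j.*2 <= n by rewrite En leq_double.
    have /eqP := coef_sym _ le_j2m; rewrite !coef_fibp2 natF2_eq.
    rewrite En -doubleB -!doubleD !odd_double !doubleK !mul1n -!mul2n => /eqP <-.
    have -> : m + (m - j) = 2 * m - j by rewrite addnBA // mul2n addnn.
    (* The mirrored coefficient is C(2m-j, 2m-2j), equal to C(2m-j, j) by symmetry. *)
    rewrite -bin_sub; last by rewrite mul2n -addnn -addnBA // (leq_trans le_jm) ?leq_addr.
    by congr (odd 'C(_, _)); rewrite mulnBr !mul2n -!addnn subnDA.
  (* [hn] rules out m = 0. For m = 3, 4 the coefficient of x^2 is C(4, 2) or C(5, 2), even, but its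
     mirror is C(5, 4) or C(7, 6), odd. *)
  have := coef_sym 2; move: hn; rewrite En {nz sym coef_sym even_n En}.
  case: m lt_m5 => [|[|[|[|[|]]]]] //= _ hn; [by left | by right | |];
    by move=> /(_ isT)/eqP; rewrite !coef_fibp2 natF2_eq.
(* Modulo 2, f_3 = x^2 + 1 and f_5 = x^4 + x^2 + 1. *)
split.
  by move/(congr1 (fun p : {poly _} => size p)); rewrite size_fibp2 size_poly0;
     case: n35 => ->.
apply/polyP => i; rewrite /recip [LHS]coef_poly size_fibp2.
case: ltnP => [lt_in | le_ni]; last first.
  by rewrite nth_default // size_fibp2.
apply/eqP; case: n35 lt_in => -> /=;
  by do 5?[case: i => [|i] //=]; rewrite ?coef_fibp2 ?natF2_eq.
Qed.
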